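(* Let $X$ be a Hausdorff space, and let $\mathfrak{B}(X)$ denote the Boolean algebra of clopen subsets of $X$. The following are equivalent. (1) $X$ is ultraparacompact. (2) $X$ is ultranormal and paracompact. (3) $X$ is strongly zero-dimensional and paracompact. (4) Every open cover of $X$ has a locally finite clopen refinement (a locally finite cover of $X$ by clopen sets that refines it). (5) $X$ is zero-dimensional and satisfies the following property: if $I$ is an ideal on the Boolean algebra $\mathfrak{B}(X)$ such that $\bigcup I = X$ and such that $\bigcup (P\cap I)\in I$ for every partition $P$ of $X$ into clopen sets, then $I=\mathfrak{B}(X)$. (6) $X$ is zero-dimensional and satisfies the following property: if $I$ is an ideal on $\mathfrak{B}(X)$ such that $\bigcup(P\cap I)\in I$ for every partition $P$ of $X$ into clopen sets, then there is an open set $O\subseteq X$ with $I=\{R\in\mathfrak{B}(X) \mid R\subseteq O\}$. (7) $X$ has a compatible supercomplete non-Archimedean uniformity (compatible meaning that it induces the topology of $X$).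
   Context: A Hausdorff space is ultraparacompact if every open cover can be refined by a partition of the space into clopen sets. A Hausdorff space is ultranormal if whenever $R,S$ are disjoint closed sets there is a clopen set $C$ with $R\subseteq C$ and $S\subseteq C^{c}$. A Hausdorff space is zero-dimensional if it has a basis of clopen sets. A Hausdorff space is paracompact if every open cover has a locally finite open refinement. A subset $Z$ of $X$ is a zero set if $Z=f^{-1}[\{0\}]$ for some continuous $f:X\to[0,1]$. A completely regular space $X$ is strongly zero-dimensional if whenever $Z_1,Z_2$ are disjoint zero sets there is a clopen set $C$ with $Z_1\subseteq C$ and $Z_2\subseteq C^{c}$ (being strongly zero-dimensional includes being completely regular). A family $\mathcal{R}$ of subsets of $X$ is locally finite if each $x\in X$ has a neighborhood $U$ such that $\{R\in\mathcal{R}\mid U\cap R\neq\emptyset\}$ is finite. Ideals on $\mathfrak{B}(X)$ are not required to be proper. A uniform space $(X,\mathcal{U})$ is non-Archimedean if for each $R\in\mathcal{U}$ there is an equivalence relation $E\in\mathcal{U}$ with $E\subseteq R$. For a uniform space $(X,\mathcal{U})$, let $H(X)$ be the set of all closed subsets of $X$. For $E\in\mathcal{U}$ and $D\subseteq X$ put $E[D]=\{y\in X\mid (x,y)\in E \text{ for some } x\in D\}$, and let $\hat{E}$ be the relation on $H(X)$ with $(C,D)\in\hat{E}$ if and only if $C\subseteq E[D]$ and $D\subseteq E[C]$. The system $\{\hat{E}\mid E\in\mathcal{U}\}$ generates a uniformity $\hat{\mathcal{U}}$ on $H(X)$, the hyperspace uniformity. The uniform space $(X,\mathcal{U})$ is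 supercomplete if $(H(X),\hat{\mathcal{U}})$ is a complete uniform space. *)

(* Defs.v *)
From HB Require Import structures.
From mathcomp Require Import all_boot all_order all_algebra.
From mathcomp Require Import all_classical all_reals all_analysis.
Import numFieldNormedType.Exports.

Set Implicit Arguments.
Unset Strict Implicit.
Unset Printing Implicit Defensive.

Local Open Scope classical_set_scope.
Local Open Scope ring_scope.

(* None of the definitions below includes the Hausdorff axiom: it has to be
   assumed separately where it is wanted. *)

Section covers.
Context {X : topologicalType}.
Implicit Types F G P : set (set X).

Definition open_cover F := F `<=` open /\ cover F id = [set: X].

Definition clopen_cover F := F `<=` clopen /\ cover F id = [set: X].

(* The blocks of a [partition] are nonempty. *)
Definition clopen_partition P := P `<=` clopen /\ partition P id [set: X].

Definition refines F G := forall A, F A -> exists2 B, G B & A `<=` B.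

Definition locally_finite F :=
  forall x : X, exists2 U, nbhs x U &
    finite_set [set A | F A /\ U `&` A !=set0].

End covers.

Section separation.
Variable X : topologicalType.

Definition ultraparacompact := forall F : set (set X), open_cover F ->
  exists2 P, clopen_partition P & refines P F.

Definition paracompact := forall F : set (set X), open_cover F ->
  exists G, [/\ open_cover G, locally_finite G & refines G F].

Definition ultranormal := forall A B : set X,
  closed A -> closed B -> A `&` B = set0 ->
  exists C, [/\ clopen C, A `<=` C & B `<=` ~` C].

(* The library's [zero_dimensional] is a weaker property: it only asks that
   distinct points be separated by clopen sets. *)
Definition has_clopen_basis :=
  exists2 B : set (set X), basis B & B `<=` clopen.

Definition zero_set (R : realType) (Z : set X) := exists f : X -> R,
  [/\ continuous f, range f `<=` `[0, 1] & Z = f @^-1` [set 0]].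

Definition strongly_zero_dimensional (R : realType) :=
  completely_regular_space X /\
  forall Z1 Z2 : set X, zero_set R Z1 -> zero_set R Z2 -> Z1 `&` Z2 = set0 ->
    exists C, [/\ clopen C, Z1 `<=` C & Z2 `<=` ~` C].

End separation.

Section clopen_ideals.
Context {X : topologicalType}.
Implicit Types I P : set (set X).

(* Ideals of the Boolean algebra of clopen sets, not necessarily proper. *)
Definition clopen_ideal I := [/\ I `<=` clopen, I set0,
  (forall A B, clopen A -> A `<=` B -> I B -> I A) &
  (forall A B, I A -> I B -> I (A `|` B))].

Definition partition_closed I :=
  forall P, clopen_partition P -> I (\bigcup_(A in P `&` I) A).

End clopen_ideals.

Section uniform.
Local Open Scope relation_scope.

Definition is_equivalence {T : Type} (E : set (T * T)) :=
  [/\ diagonal `<=` E, E^-1 `<=` E & E \; E `<=` E].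

Definition non_archimedean (U : uniformType) :=
  forall A : set (U * U), entourage A ->
    exists E, [/\ entourage E, is_equivalence E & E `<=` A].

(* Completeness as in [completeType], without requiring a point. *)
Definition complete_uniformity (U : uniformType) :=
  forall F : set_system U, ProperFilter F -> cauchy F -> exists l : U, F --> l.

Definition rel_image {T : Type} (E : set (T * T)) (D : set T) : set T :=
  [set y | exists2 x, D x & E (x, y)].

(* All closed subsets, including the empty one. *)
Definition hyperspace (U : uniformType) : Type := {C : set U | closed C}.

Definition hyper_rel {U : uniformType} (E : set (U * U)) :
    set (hyperspace U * hyperspace U) :=
  [set CD | sval CD.1 `<=` rel_image E (sval CD.2) /\
            sval CD.2 `<=` rel_image E (sval CD.1)].

Definition hyper_entourage (U : uniformType) :
    set_system (hyperspace U * hyperspace U) :=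
  filter_from entourage hyper_rel.

Section hyperspace_uniformity.
Variable U : uniformType.

Lemma hyper_relS (E F : set (U * U)) :
  E `<=` F -> hyper_rel E `<=` hyper_rel F.
Proof.
move=> EF [C D] [/= CE DE]; split=> /= x.
- by move=> /CE[y Dy Eyx]; exists y => //; exact: EF.
- by move=> /DE[y Cy Eyx]; exists y => //; exact: EF.
Qed.

Lemma hyper_entourage_filter : Filter (hyper_entourage (U := U)).
Proof.
apply: filter_from_filter; first by exists setT; exact: filterT.
move=> E F entE entF; exists (E `&` F); first exact: filterI.
by move=> p pEF; split; move: p pEF; apply: hyper_relS => ? [].
Qed.

Lemma hyper_entourage_diagonal A :
  hyper_entourage (U := U) A -> diagonal `<=` A.
Proof.
move=> [E entE EA] [C D] CD; apply: EA; have -> : C = D by [].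
by split=> x /= Dx; exists x => //; exact: entourage_refl.
Qed.

Lemma hyper_entourage_inv A :
  hyper_entourage (U := U) A -> hyper_entourage (A^-1).
Proof. by move=> [E entE EA]; exists E => // -[C D] [CD DC]; exact: EA. Qed.

Lemma hyper_entourage_split A : hyper_entourage (U := U) A ->
  exists2 B, hyper_entourage B & B \; B `<=` A.
Proof.
move=> [E entE EA]; have [F entF FE] := entourage_split_ex entE.
exists (hyper_rel F); first by exists F.
move=> [C D] [B /= [CB BC] [BD DB]]; apply: EA; split=> /= x.
- by move=> /CB[y /BD[z Dz Fzy] Fyx]; exists z => //; apply: FE; exists y.
- by move=> /DB[y /BC[z Cz Fzy] Fyx]; exists z => //; apply: FE; exists y.
Qed.

End hyperspace_uniformity.

HB.instance Definition _ (U : uniformType) := gen_eqMixin (hyperspace U).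
HB.instance Definition _ (U : uniformType) := gen_choiceMixin (hyperspace U).
HB.instance Definition _ (U : uniformType) := isUniform.Build (hyperspace U)
  (@hyper_entourage_filter U) (@hyper_entourage_diagonal U)
  (@hyper_entourage_inv U) (@hyper_entourage_split U).

Definition supercomplete (U : uniformType) :=
  complete_uniformity (hyperspace U).

(* Quantifies over all uniform structures on the carrier of [X]; each of them
   carries its own topology, which has to be the one of [X]. *)
Definition has_supercomplete_non_archimedean_uniformity (X : topologicalType) :=
  exists m : Uniform.axioms_ X, let U := Uniform.Pack m in
    [/\ @open U = @open X,
        non_archimedean U & supercomplete U].

End uniform.

(* Main.v *)
From HB Require Import structures.
Require Import Defs.
From mathcomp Require Import all_boot all_order all_algebra.
From mathcomp Require Import all_classical all_reals all_analysis.
Import GRing.Theory Num.Theory numFieldNormedType.Exports.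

Set Implicit Arguments.
Unset Strict Implicit.
Unset Printing Implicit Defensive.

Local Open Scope classical_set_scope.

(** The statements about covers are linked by turning one kind of refinement
into another.  The blocks of a clopen partition form a locally finite family,
so the union of any set of blocks is clopen; this gives ultranormality and
paracompactness ([ultraparacompact_ultranormal],
[ultraparacompact_paracompact]), and ultranormality separates zero sets.  From
strong zero-dimensionality and paracompactness, one first gets a clopen basis,
hence regularity, and then normality by the usual argument with closures of
locally finite families.  A locally finite open refinement is then shrunk to
closed sets, each of which is separated by Urysohn's lemma, and hence by a
clopen set, from the complement of the open set that it shrinks
([strongly_zero_dimensional_paracompact_clopen_refinement]).  Finally, a locally
finite clopen cover is made disjoint along a well-order of its members: the
unions that are removed are clopen, because they are locally finite
([locally_finite_clopen_partition]).

The ideal conditions are handled as follows.  An ideal that covers the space is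
itself an open cover; a clopen partition refining it lies in the ideal, and
closure under partitions puts the whole space in the ideal
([ultraparacompact_ideal]).  Conversely, for an open cover, the clopen sets
which have a locally finite clopen refinement of the cover form an ideal to
which the hypothesis applies ([ideal_clopen_refinement]).  The description of
all partition-closed ideals by open sets follows from the case of covering
ideals by testing membership after intersection with a fixed clopen set
([trace_ideal]).

The uniformity used for an ultraparacompact space is the one generated by the
clopen partitions.  Two closed sets are close for a partition when they meet the
same blocks.  The limit of a Cauchy filter of closed sets consists of the
points no clopen neighbourhood of which is eventually missed by the sets of the
filter, and ultraparacompactness is used to show that every block met along the filter is
met by this limit ([partition_space_supercomplete]).  Conversely, given a
supercomplete non-Archimedean uniformity and a partition-closed covering ideal,
the complements of the members of the ideal form a Cauchy filter base: given an
equivalence entourage, the union of its classes which lie in the ideal belongs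
to the ideal, and from there on the complements meet exactly the other classes.
Its limit is the empty set since the ideal covers the space, and only the empty
set is close to the empty set, so the ideal contains the whole space
([supercomplete_ideal]). *)

(** * Locally finite families and clopen partitions *)

Section locally_finite_families.
Context {X : topologicalType}.
Implicit Types (F G P Q : set (set X)) (A B C : set X).

Lemma sub_locally_finite F G : F `<=` G -> locally_finite G -> locally_finite F.
Proof.
move=> FG lfG x; have [U Ux finU] := lfG x; exists U => //.
by apply: sub_finite_set finU => A [/FG].
Qed.

Lemma locally_finiteU F G :
  locally_finite F -> locally_finite G -> locally_finite (F `|` G).
Proof.
move=> lfF lfG x; have [U Ux finU] := lfF x; have [V Vx finV] := lfG x.
exists (U `&` V); first exact: filterI.
have : finite_set ([set A | F A /\ U `&` A !=set0] `|`
                    [set A | G A /\ V `&` A !=set0]) by rewrite finite_setU.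
apply: sub_finite_set.
by move=> A [[FA|GA] [y [[Uy Vy] Ay]]]; [left|right]; split=> //; exists y.
Qed.

Lemma locally_finite_image (f : set X -> set X) G :
  (forall A, G A -> f A `<=` A) -> locally_finite G ->
  locally_finite (f @` G).
Proof.
move=> fG lfG x; have [U Ux finU] := lfG x; exists U => //.
apply: sub_finite_set (finite_image f finU).
move=> _ [[A GA <-] [y [Uy fAy]]]; exists A => //; split=> //.
by exists y; split=> //; exact: fG fAy.
Qed.

(** Near a given point, the union is a finite one, and finite unions of closed
sets are closed. *)
Lemma closure_bigcup_locally_finite F : locally_finite F ->
  closure (\bigcup_(A in F) A) `<=` \bigcup_(A in F) closure A.
Proof.
move=> lfF x clFx; have [U Ux finU] := lfF x; apply: contrapT => nFx.
pose K := \bigcup_(A in [set A | F A /\ U `&` A !=set0]) closure A.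
have /closed_openC opK : closed K.
  by apply: closed_bigcup => // A _; exact: closed_closure.
have Kx : (~` K) x by move=> [A [FA _] clAx]; apply: nFx; exists A.
have [y [[A FA Ay] [Uy]]] := clFx _ (filterI Ux (open_nbhs_nbhs (conj opK Kx))).
by apply; exists A; [split => //; exists y | exact: subset_closure].
Qed.

(** This is how closed sets are built inside the members of an open cover in
the shrinking and normality arguments below. *)
Lemma closure_bigcup_sub F A : locally_finite F ->
  closure (\bigcup_(B in [set B | F B /\ closure B `<=` A]) B) `<=` A.
Proof.
move=> lfF x /closure_bigcup_locally_finite[|B [FB BA] clBx]; last exact: BA.
by apply: sub_locally_finite lfF => B [].
Qed.

Lemma clopen_bigcup_locally_finite F :
  F `<=` clopen -> locally_finite F -> clopen (\bigcup_(A in F) A).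
Proof.
move=> cF lfF; split; first by apply: bigcup_open => i /cF[].
move=> x /(closure_bigcup_locally_finite lfF)[A FA clAx].
by exists A => //; have [_] := cF _ FA; exact.
Qed.

Lemma clopen_setD A B : clopen A -> clopen B -> clopen (A `\` B).
Proof. by move=> cA cB; apply: clopenI => //; apply: clopenC. Qed.

Lemma clopen_partitionP P : clopen_partition P <->
  [/\ P `<=` clopen, forall A, P A -> A !=set0,
      forall x, exists2 A, P A & A x &
      forall A B x, P A -> P B -> A x -> B x -> A = B].
Proof.
split=> [[cP [covP trP neP]]|[cP neP covP trP]]; split => //.
- move=> x; have [A PA Ax] : cover P id x by rewrite covP.
  by exists A.
- by move=> A B x PA PB Ax Bx; apply: trP => //; exists x.
- by split=> //; [rewrite -subTset => x _; have [A] := covP x; exists A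
    |move=> A B PA PB [x [Ax Bx]]; exact: (trP A B x)].
Qed.

(** Disjoint clopen covers are built below by formulas that may produce empty
sets, which have to be discarded before speaking of blocks. *)
Lemma clopen_partition_nonempty G : G `<=` clopen ->
  (forall x, exists2 A, G A & A x) ->
  (forall A B x, G A -> G B -> A x -> B x -> A = B) ->
  clopen_partition [set A | G A /\ A !=set0].
Proof.
move=> cG covG trG; apply/clopen_partitionP; split.
- by move=> A [/cG].
- by move=> A [].
- by move=> x; have [A GA Ax] := covG x; exists A => //; split=> //; exists x.
- by move=> A B x [GA _] [GB _]; exact: trG.
Qed.

Lemma clopen_partition_setC A : clopen A ->
  clopen_partition [set B | [set A; ~` A] B /\ B !=set0].
Proof.
move=> cA; apply: clopen_partition_nonempty.
- by move=> _ [->|->] //; exact: clopenC.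
- move=> x; have [Ax|nAx] := pselect (A x); first by exists A => //; left.
  by exists (~` A) => //; right.
- by move=> _ _ x [->|->] [->|->].
Qed.

Lemma clopen_partition_locally_finite P :
  clopen_partition P -> locally_finite P.
Proof.
move=> /clopen_partitionP[cP _ covP trP] x; have [A PA Ax] := covP x.
exists A; first by apply: open_nbhs_nbhs; split=> //; have [] := cP _ PA.
apply: (sub_finite_set (B := [set A])); last exact: finite_set1.
by move=> B [PB [y [Ay By]]]; exact: trP By Ay.
Qed.

Lemma clopen_partition_bigcup P Q : clopen_partition P -> Q `<=` P ->
  clopen (\bigcup_(A in Q) A).
Proof.
move=> partP QP; apply: clopen_bigcup_locally_finite.
  by move=> A /QP; case: partP => + _; apply.
exact/sub_locally_finite/clopen_partition_locally_finite/partP.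
Qed.

(** The members of the cover are well-ordered, and from each one the union of
the strictly smaller ones is removed: what remains of [A] is the set of points
for which [A] is the first member containing them.  It is clopen because the
removed union is that of a locally finite family of clopen sets. *)
Lemma locally_finite_clopen_partition G :
  clopen_cover G -> locally_finite G ->
  exists2 P, clopen_partition P & refines P G.
Proof.
move=> [cG covG] lfG.
(* The well-ordering theorem asks for decidable equality on sets, which holds
   classically. *)
have [R woR] := wochoice.well_ordering_principle {classic set X}.
pose first A x := G A /\ A x /\ forall B, G B -> B x -> R A B.
have firstP x : exists! A, first A x.
  pose F := [pred B | `[< G B /\ B x >]].
  have firstE A : first A x <-> wochoice.minimum_of R F A.
    split=> [[GA [Ax lA]]|[/asboolP[GA Ax] lA]].
      by split=> [|B /asboolP[GB Bx]]; [exact/asboolP | exact: lA].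
    by split=> //; split=> // B GB Bx; apply: lA; apply/asboolP.
  have [A GA Ax] : cover G id x by rewrite covG.
  have [|M [minM uM]] := woR F; first by exists A; apply/asboolP.
  by exists M; split=> [|B /firstE]; [exact/firstE | exact: uM].
pose D A := A `\` \bigcup_(B in [set B | G B /\ ~~ R A B]) B.
have DE A : G A -> D A = [set x | first A x].
  move=> GA; apply/seteqP; split=> x /=.
    move=> [Ax nx]; split=> //; split=> // B GB Bx; apply: contrapT => /negP nR.
    by apply: nx; exists B.
  move=> [_ [Ax lA]]; split=> // -[B [GB /negP nR] Bx]; apply: nR; exact: lA.
exists [set B | (D @` G) B /\ B !=set0].
  apply: clopen_partition_nonempty.
  - move=> _ [A GA <-]; apply: clopen_setD; first exact: cG.
    apply: clopen_bigcup_locally_finite; first by move=> B [/cG].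
    by apply: sub_locally_finite lfG => B [].
  - move=> x; have [A [fA _]] := firstP x; have GA : G A by case: fA.
    by exists (D A); [exists A|rewrite DE].
  - move=> _ _ x [A GA <-] [B GB <-].
    rewrite !DE //= => fA fB; have [M [_ uM]] := firstP x.
    by rewrite -(uM A) // -(uM B).
by move=> _ [[A GA <-] _]; exists A => //; exact: subDsetl.
Qed.

End locally_finite_families.

(** * Refinements, normality and strong zero-dimensionality *)

Definition locally_finite_clopen_refinements (X : topologicalType) :=
  forall F : set (set X), open_cover F ->
    exists G, [/\ clopen_cover G, locally_finite G & refines G F].

Section separation_and_refinement.
Context {X : topologicalType}.
Implicit Types (F G P : set (set X)) (A B C : set X).

Lemma open_cover_complements A B : closed A -> closed B -> A `&` B = set0 ->
  open_cover [set ~` A; ~` B].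
Proof.
move=> cA cB AB0; split; first by move=> _ [|] ->; exact: closed_openC.
rewrite -subTset => x _; have [Ax|nAx] := pselect (A x).
  exists (~` B); [by right | move=> Bx].
  by have : (A `&` B) x by []; rewrite AB0.
by exists (~` A) => //; left.
Qed.

Lemma has_clopen_basisP : has_clopen_basis X <->
  forall x (O : set X), open O -> O x ->
    exists C, [/\ clopen C, C x & C `<=` O].
Proof.
split=> [[B [_ basB] cB] x O oO Ox|basX].
  have [C [BC Cx] CO] := basB x O (open_nbhs_nbhs (conj oO Ox)).
  by exists C; split=> //; exact: cB.
exists clopen => //; split=> [A [] // |x N].
rewrite nbhsE => -[W [oW Wx] WN]; have [C [cC Cx CW]] := basX x W oW Wx.
by exists C => //; exact: subset_trans WN.
Qed.

(** For disjoint closed sets, each block of a partition refining the cover by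
their complements meets at most one of them; the blocks meeting the first one
separate it from the second. *)
Lemma ultraparacompact_ultranormal : ultraparacompact X -> ultranormal X.
Proof.
move=> uX A B cA cB AB0.
have [P partP refP] := uX _ (open_cover_complements cA cB AB0).
have [cP neP covP trP] := (clopen_partitionP P).1 partP.
exists (\bigcup_(D in [set D | P D /\ D `&` A !=set0]) D); split.
- by apply: clopen_partition_bigcup partP _ => D [].
- move=> x Ax; have [D PD Dx] := covP x; exists D => //.
  by split=> //; exists x.
- move=> x Bx [D [PD [y [Dy Ay]]] Dx].
  by have [E [] -> DE] := refP _ PD; [exact: (DE y) | exact: (DE x)].
Qed.

Lemma ultraparacompact_paracompact : ultraparacompact X -> paracompact X.
Proof.
move=> uX F oF; have [P partP refP] := uX F oF; exists P; split=> //.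
  by case: partP => cP [covP _ _]; split=> // A /cP[].
exact: clopen_partition_locally_finite.
Qed.

Lemma ultranormal_strongly_zero_dimensional (R : realType) :
  hausdorff_space X -> ultranormal X -> strongly_zero_dimensional X R.
Proof.
move=> hX uX; split.
  apply: (@normal_completely_regular R); last exact: hausdorff_accessible.
  apply/(@normal_openP R) => A B cA cB AB0.
  have [C [cC AC BC]] := uX A B cA cB AB0.
  exists C, (~` C); split=> //; [by case: cC | |exact: setICr].
  by apply: closed_openC; case: cC.
have cZ (Z : set X) : zero_set R Z -> closed Z.
  move=> [f [cf _ ->]]; move/continuous_closedP: cf; apply.
  exact: closed_eq.
by move=> Z1 Z2 /cZ cZ1 /cZ cZ2; exact: uX.
Qed.

(** Sets separated by a real function lie in two disjoint zero sets, those of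
[f] and [1 - f]. *)
Lemma clopen_separation (R : realType) A B : strongly_zero_dimensional X R ->
  uniform_separator A B -> exists C, [/\ clopen C, A `<=` C & B `<=` ~` C].
Proof.
move=> [_ sX] /(@uniform_separatorP _ R)[f [cf f01 fA fB]].
have [|||C [cC AC BC]] := sX (f @^-1` [set 0%R])
  ((fun x => (1 - f x)%R) @^-1` [set 0%R]).
- by exists f.
- exists (fun x => (1 - f x)%R); split=> //.
    move=> x; apply: cvgB; [exact: cvg_cst | exact: cf].
  move=> _ [x _ <-]; have := f01 (f x); rewrite /= !in_itv/=.
  by move=> /(_ (imageT _ _))/andP[f0 f1]; rewrite subr_ge0 f1 gerBl.
- rewrite -subset0 => x [/= ->]; rewrite subr0 => /eqP.
  by rewrite oner_eq0.
exists C; split=> // x; first by move=> Ax; apply: AC; apply: fA; exists x.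
move=> Bx; apply: BC => /=; by rewrite (fB (f x)) ?subrr//; exists x.
Qed.

Lemma strongly_zero_dimensional_clopen_basis (R : realType) :
  strongly_zero_dimensional X R -> has_clopen_basis X.
Proof.
move=> sX; apply/has_clopen_basisP => x O oO Ox.
have [|C [cC xC OC]] := clopen_separation (A := [set x]) (B := ~` O) sX.
  by apply: sX.1 => //; exact: open_closedC.
exists C; split=> //; first exact: xC.
by move=> y Cy; apply: contrapT => /OC.
Qed.

(** The clopen sets contained in members of [F] form an open cover; a set
contained in one of them has its closure contained in the same one. *)
Lemma paracompact_closure_refinement F :
  has_clopen_basis X -> paracompact X -> open_cover F ->
  exists G, [/\ open_cover G, locally_finite G &
    forall A, G A -> exists2 B, F B & closure A `<=` B].
Proof.
move=> /has_clopen_basisP basX pX [oF covF].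
have [|G [oG lfG refG]] := pX [set C | clopen C /\ exists2 B, F B & C `<=` B].
  split=> [C [[]] // |]; rewrite -subTset => x _.
  have [B FB Bx] : cover F id x by rewrite covF.
  by have [C [cC Cx CB]] := basX x B (oF _ FB) Bx; exists C => //;
    split=> //; exists B.
exists G; split=> // A /refG[C [cC [B FB CB]] AC]; exists B => //.
apply: subset_trans CB; rewrite (closure_id C).1; [exact: closure_subset|].
by case: cC.
Qed.

(** In a refinement, by closures, of the cover by the complements of [A] and
[B], the members that meet [A] have their closures outside [B]; the closure of
the union of all members with closure outside [B] still avoids [B]. *)
Lemma paracompact_normal (R : realType) :
  has_clopen_basis X -> paracompact X -> normal_space X.
Proof.
move=> basX pX; apply/(@normal_openP R) => A B cA cB AB0.
have [G [[oG covG] lfG refG]] := paracompact_closure_refinement basX pX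
  (open_cover_complements cA cB AB0).
pose V := \bigcup_(D in [set D | G D /\ closure D `<=` ~` B]) D.
exists V, (~` closure V); split.
- by apply: bigcup_open => D [/oG].
- exact/closed_openC/closed_closure.
- move=> x Ax; have [D GD Dx] : cover G id x by rewrite covG.
  exists D => //; split=> //; have [E [] -> //] := refG _ GD.
  by move=> /(_ x (subset_closure Dx)).
- by move=> x Bx /(closure_bigcup_sub lfG); apply.
- by rewrite -subset0 => x [/subset_closure].
Qed.

(** A locally finite open refinement [G] is shrunk to closed sets [K A], for [A]
in [G], that still cover the space, and a clopen set is inserted between [K A]
and [A].  The clopen sets inherit local finiteness from [G]. *)
Lemma strongly_zero_dimensional_paracompact_clopen_refinement (R : realType) :
  strongly_zero_dimensional X R -> paracompact X ->
  locally_finite_clopen_refinements X.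
Proof.
move=> sX pX F oF; have basX := strongly_zero_dimensional_clopen_basis sX.
have [G [oG lfG refG]] := pX F oF.
have [W [[oW covW] lfW refW]] := paracompact_closure_refinement basX pX oG.
pose K A := closure (\bigcup_(B in [set B | W B /\ closure B `<=` A]) B).
have sepK A : exists D, G A -> [/\ clopen D, K A `<=` D & D `<=` A].
  have [GA|nGA] := pselect (G A); last by exists A.
  have [|D [cD KD AD]] := clopen_separation (A := K A) (B := ~` A) sX.
    apply: normal_uniform_separator; first exact: (paracompact_normal R).
    - exact: closed_closure.
    - by apply: open_closedC; exact: oG.1.
    - by rewrite -subset0 => x [/(closure_bigcup_sub lfW)].
  by exists D => _; split=> // x Dx; apply: contrapT => /AD.
have [D DP] := choice sepK.
exists (D @` G); split.
- split; first by move=> _ [A /DP[cD _ _] <-].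
  rewrite -subTset => x _; have [B WB Bx] : cover W id x by rewrite covW.
  have [A GA BA] := refW _ WB; have [_ KD _] := DP A GA.
  exists (D A); first by exists A.
  by apply: KD; apply: subset_closure; exists B.
- by apply: locally_finite_image lfG => A /DP[].
- move=> _ [A GA <-]; have [_ _ DA] := DP A GA.
  by have [B FB AB] := refG _ GA; exists B => //; exact: subset_trans AB.
Qed.

Lemma clopen_refinement_ultraparacompact :
  locally_finite_clopen_refinements X -> ultraparacompact X.
Proof.
move=> rX F /rX[G [cG lfG refG]].
have [P partP refP] := locally_finite_clopen_partition cG lfG.
exists P => // A /refP[B GB AB]; have [C FC BC] := refG _ GB.
by exists C => //; exact: subset_trans BC.
Qed.

End separation_and_refinement.

(** * Ideals of clopen sets *)

Definition covering_ideals_improper (X : topologicalType) :=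
  forall I : set (set X), clopen_ideal I -> \bigcup_(A in I) A = [set: X] ->
    partition_closed I -> I = clopen.

Section ideals.
Context {X : topologicalType}.
Implicit Types (F G P I : set (set X)) (A B C : set X).

(** A clopen partition refining the open cover [I] consists of members of [I],
and its union is the whole space. *)
Lemma ultraparacompact_ideal :
  ultraparacompact X -> covering_ideals_improper X.
Proof.
move=> uX I [cI _ sI _] covI pI.
have [|P partP refP] := uX I; first by split=> // A /cI[].
have IT : I setT.
  have := pI P partP; congr I; rewrite -subTset => x _.
  have [_ _ covP _] := (clopen_partitionP P).1 partP.
  have [A PA Ax] := covP x; exists A => //; split=> //.
  by have [B IB AB] := refP _ PA; apply: sI IB => //; exact: partP.1.
by apply/seteqP; split=> // A cA; exact: sI IT.
Qed.

(** The ideal consists of the clopen sets [A] that are unions of locally finite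
families of clopen sets refining [F].  It contains the clopen subsets of the
members of [F], hence covers the space.  It is closed under partitions because
families chosen inside the blocks of a partition are jointly locally finite:
each point has its block as a neighbourhood, which meets only the family chosen
for that block.  Asking for local finiteness instead of disjointness makes the
union of two families an admissible family. *)
Lemma ideal_clopen_refinement : has_clopen_basis X ->
  covering_ideals_improper X -> locally_finite_clopen_refinements X.
Proof.
move=> /has_clopen_basisP basX idealX F [oF covF].
pose good A G :=
  [/\ G `<=` clopen, cover G id = A, locally_finite G & refines G F].
pose I := [set A | clopen A /\ exists G, good A G].
suff IT : I setT by have [_ [G [cG covG lfG refG]]] := IT; exists G.
have small A B : F B -> clopen A -> A `<=` B -> I A.
  move=> FB cA AB; split=> //; exists [set A]; split.
  - by move=> _ ->.
  - by rewrite /cover bigcup_set1.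
  - move=> x; exists setT; first exact: filterT.
    by apply: sub_finite_set (finite_set1 A) => C [].
  - by move=> _ ->; exists B.
rewrite (idealX I); first exact: clopenT.
- split.
  + by move=> A [].
  + split; first exact: clopen0.
    exists set0; split=> //; first by rewrite /cover bigcup_set0.
    move=> x; exists setT; first exact: filterT.
    by apply: sub_finite_set (finite_set0 _) => C [].
  + move=> A B cA AB [cB [G [cG covG lfG refG]]]; split=> //.
    exists ((fun C => C `&` A) @` G); split.
    * by move=> _ [C GC <-]; apply: clopenI => //; exact: cG.
    * rewrite /cover bigcup_image /= -setI_bigcupl -/(cover G id) covG.
      exact: setIidr.
    * apply: locally_finite_image lfG => C _; exact: subIsetl.
    * move=> _ [C GC <-]; have [D FD CD] := refG _ GC; exists D => //.
      by apply: subset_trans CD; exact: subIsetl.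
  + move=> A B [cA [G [cG covG lfG refG]]] [cB [H [cH covH lfH refH]]].
    split; first exact: clopenU.
    exists (G `|` H); split; last by move=> C [/refG|/refH].
    * by move=> C [/cG|/cH].
    * by rewrite /cover bigcup_setU -/(cover G id) covG -/(cover H id) covH.
    * exact: locally_finiteU.
- rewrite -subTset => x _; have [B FB Bx] : cover F id x by rewrite covF.
  have [A [cA Ax AB]] := basX x B (oF _ FB) Bx; exists A => //.
  exact: small AB.
- move=> P partP; split.
    by apply: clopen_partition_bigcup partP _ => A [].
  have [cP neP covP trP] := (clopen_partitionP P).1 partP.
  have exG A : exists G, I A -> good A G.
    have [[_ [G gG]]|nI] := pselect (I A); first by exists G.
    by exists set0.
  have [G GP] := choice exG.
  exists (\bigcup_(A in P `&` I) G A); split.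
  + by move=> C [A [_ /GP[cG _ _ _]]]; exact: cG.
  + apply/seteqP; split=> x.
      move=> [C [A [PA IA] GC] Cx]; exists A => //.
      by have [_ <- _ _] := GP A IA; exists C.
    move=> [A [PA IA] Ax]; have [_ covG _ _] := GP A IA.
    have [C GC Cx] : cover (G A) id x by rewrite covG.
    by exists C => //; exists A.
  + move=> x; have [A PA Ax] := covP x.
    have nA : nbhs x A by apply: open_nbhs_nbhs; split=> //; exact: (cP A PA).1.
    have GA B C : P B -> I B -> G B C -> A `&` C !=set0 -> B = A.
      move=> PB IB GC [y [Ay Cy]]; have [_ covG _ _] := GP B IB.
      by apply: (trP _ _ y) => //; rewrite -covG; exists C.
    have [IA|nIA] := pselect (I A); last first.
      exists A => //; apply: sub_finite_set (finite_set0 _).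
      move=> C [[B [PB IB] GC] AC]; apply: nIA.
      by rewrite -(GA _ _ PB IB GC AC).
    have [_ _ /(_ x)[U Ux finU] _] := GP A IA.
    exists (U `&` A); first exact: filterI.
    apply: sub_finite_set finU => C [[B [PB IB] GC] [y [[Uy Ay] Cy]]].
    rewrite -(GA _ _ PB IB GC); last by exists y.
    by split=> //; exists y.
  + by move=> C [A [_ /GP[_ _ _ refG]]]; exact: refG.
Qed.

(** The open set is the union of [I].  To see that a clopen set [R] contained in
it belongs to [I], apply the hypothesis to the ideal [J] of the clopen sets
whose intersection with [R] is in [I]: it covers the space because it contains
both [I] and the complement of [R]. *)
Lemma trace_ideal : covering_ideals_improper X ->
  forall I, clopen_ideal I -> partition_closed I ->
    exists2 O, open O & I = [set A | clopen A /\ A `<=` O].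
Proof.
move=> idealX I [cI I0 sI uI] pI; exists (\bigcup_(A in I) A).
  by apply: bigcup_open => A /cI[].
apply/seteqP; split=> [A IA|R [cR RO]].
  by split; [exact: cI | move=> x Ax; exists A].
pose J := [set A | clopen A /\ I (A `&` R)].
suff [_] : J setT by rewrite setTI.
rewrite (idealX J); first exact: clopenT.
- split.
  + by move=> A [].
  + by split; [exact: clopen0 | rewrite set0I].
  + move=> A B cA AB [cB IB]; split=> //; apply: sI IB; first exact: clopenI.
    exact: setSI.
  + move=> A B [cA IA] [cB IB]; split; first exact: clopenU.
    by rewrite setIUl; exact: uI.
- rewrite -subTset => x _; have [Rx|nRx] := pselect (R x).
    have [A IA Ax] := RO x Rx; exists A => //; split; first exact: cI.
    apply: (sI _ A) => //; apply: clopenI => //; exact: cI.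
  exists (~` R) => //; split; first exact: clopenC.
  by rewrite setICl.
- move=> P partP; split.
    by apply: clopen_partition_bigcup partP _ => A [].
  have [cP neP covP trP] := (clopen_partitionP P).1 partP.
  (* [I] is closed under the partition formed by the traces on [R] of the blocks
     of [P] together with the complement of [R]. *)
  pose Q := [set B | (exists2 A, P A & B = A `&` R) \/ B = ~` R].
  have /pI : clopen_partition [set B | Q B /\ B !=set0].
    apply: clopen_partition_nonempty.
    + move=> _ [[A PA ->]|->]; last exact: clopenC.
      by apply: clopenI => //; exact: cP.
    + move=> x; have [Rx|nRx] := pselect (R x); last first.
        by exists (~` R) => //; right.
      have [A PA Ax] := covP x; exists (A `&` R) => //.
      by left; exists A.
    + move=> _ _ x [[A PA ->]|->] [[B PB ->]|->] //=.
      * by move=> [Ax _] [Bx _]; rewrite (trP A B x).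
      * by move=> [].
      * by move=> + [].
  apply: sI; first apply: clopenI => //.
    by apply: clopen_partition_bigcup partP _ => A [].
  move=> x [[A [PA [_ IA]] Ax] Rx]; exists (A `&` R) => //; split=> //.
  by split; [left; exists A|exists x].
Qed.

Lemma open_ideal I (O : set X) : I = [set A | clopen A /\ A `<=` O] ->
  \bigcup_(A in I) A = [set: X] -> I = clopen.
Proof.
move=> ->; rewrite -subTset => covI; apply/seteqP; split=> A; first by case.
move=> cA; split=> // x _; have [B [_ BO] Bx] := covI x Logic.I; exact: BO.
Qed.

End ideals.

(** * The uniformity of clopen partitions *)

Section partition_uniformity.
Local Open Scope relation_scope.
Context {X : topologicalType}.
Implicit Types (P : set (set X)) (A : set X).

Definition same_block P : set (X * X) :=
  [set xy | exists2 A, P A & A xy.1 /\ A xy.2].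

Definition partition_entourage : set_system (X * X) :=
  filter_from clopen_partition same_block.

Lemma same_block_equivalence P :
  clopen_partition P -> is_equivalence (same_block P).
Proof.
move=> /clopen_partitionP[_ _ covP trP]; split.
- move=> [x y]; rewrite /diagonal /= => <-; have [A PA Ax] := covP x.
  by exists A.
- by move=> [x y] [A PA [Ay Ax]]; exists A.
- move=> [x y] [z /= [A PA [/= Ax Az]] [B PB [/= Bz By]]].
  by exists A => //; split=> //=; rewrite (trP A B z).
Qed.

Lemma partition_entourage_filter : Filter partition_entourage.
Proof.
apply: filter_from_filter.
  by eexists; apply: (clopen_partition_setC clopenT).
move=> P Q /clopen_partitionP[cP _ covP trP] /clopen_partitionP[cQ _ covQ trQ].
exists [set C | [set A `&` B | A in P & B in Q] C /\ C !=set0].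
  apply: clopen_partition_nonempty.
  - by move=> _ [A PA [B QB <-]]; apply: clopenI; [exact: cP|exact: cQ].
  - move=> x; have [A PA Ax] := covP x; have [B QB Bx] := covQ x.
    by exists (A `&` B) => //; exists A => //; exists B.
  - move=> _ _ x [A PA [B QB <-]] [A' PA' [B' QB' <-]] [Ax Bx] [Ax' Bx'].
    by rewrite (trP A A' x) // (trQ B B' x).
move=> [x y] [_ [[A PA [B QB <-]] _] [[/= Ax Bx] [Ay By]]].
by split; [exists A|exists B].
Qed.

Lemma partition_entourage_diagonal E :
  partition_entourage E -> diagonal `<=` E.
Proof.
move=> [P partP PE]; apply: subset_trans PE.
by have [] := same_block_equivalence partP.
Qed.

Lemma partition_entourage_inv E :
  partition_entourage E -> partition_entourage E^-1.
Proof.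
move=> [P partP PE]; exists P => // -[x y] /= Pxy; apply: PE.
by have [_ + _] := same_block_equivalence partP; apply.
Qed.

Lemma partition_entourage_split E : partition_entourage E ->
  exists2 D, partition_entourage D & D \; D `<=` E.
Proof.
move=> [P partP PE]; exists (same_block P); first by exists P.
by apply: subset_trans PE; have [] := same_block_equivalence partP.
Qed.

End partition_uniformity.

(** A copy of the carrier of [X] that does not inherit the topology of [X], so
that it can receive the topology of the partition uniformity instead. *)
Definition partition_space (X : topologicalType) : Type := X.

HB.instance Definition _ (X : topologicalType) :=
  gen_eqMixin (partition_space X).
HB.instance Definition _ (X : topologicalType) :=
  gen_choiceMixin (partition_space X).
HB.instance Definition _ (X : topologicalType) :=
  isUniform.Build (partition_space X)
    (@partition_entourage_filter X) (@partition_entourage_diagonal X)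
    (@partition_entourage_inv X) (@partition_entourage_split X).

Section partition_space.
Context {X : topologicalType}.
Implicit Types (P : set (set X)) (A : set X).

Lemma partition_space_nbhs (x : partition_space X) (N : set X) :
  nbhs x N <-> exists2 P, clopen_partition P &
    forall A, P A -> A x -> A `<=` N.
Proof.
rewrite -filter_from_entourageE; split=> [[E [P partP PE] EN]|[P partP PN]].
  exists P => // A PA Ax y Ay; apply: EN; apply/xsectionP; apply: PE.
  by exists A.
exists (same_block P); first by exists P.
by move=> y /xsectionP[A PA [Ax Ay]]; exact: PN Ay.
Qed.

Lemma open_partition_space : has_clopen_basis X ->
  @open (partition_space X) = @open X.
Proof.
move=> /has_clopen_basisP basX.
apply/seteqP; split=> O; rewrite 2!openE => oO x Ox.
  have [P /clopen_partitionP[cP _ covP _] PO] :=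
    (partition_space_nbhs x O).1 (oO x Ox).
  have [A PA Ax] := covP x; rewrite /interior nbhsE; exists A; last exact: PO.
  by split=> //; have [] := cP _ PA.
have [C [cC Cx CO]] : exists C : set X,
    [/\ @clopen X C, C x & C `<=` (O : set X)].
  by apply: basX => //; rewrite openE.
apply/(partition_space_nbhs x O); exists [set B | [set C; ~` C] B /\ B !=set0].
  exact: clopen_partition_setC.
by move=> _ [[->|->] _].
Qed.

Lemma cauchy_small {U : uniformType} (F : set_system U) (FF : Filter F) E :
  cauchy F -> entourage E ->
  exists2 S, F S & forall p q, S p -> S q -> E (p, q).
Proof.
move=> cF /cF[[S T] [FS FT] STE]; exists (S `&` T); first exact: filterI.
by move=> p q [Sp _] [_ Tq]; exact: STE.
Qed.

Lemma hyper_rel_same_block P (C D : hyperspace (partition_space X)) A :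
  clopen_partition P ->
  @hyper_rel (partition_space X) (same_block P) (C, D) -> P A ->
  sval C `&` A !=set0 -> sval D `&` A !=set0.
Proof.
move=> /clopen_partitionP[_ _ _ trP] [CD _] PA [x [Cx Ax]].
have [y Dy [B PB [By Bx]]] := CD x Cx.
by exists y; split=> //; rewrite (trP A B x).
Qed.

(** The limit [L] of a Cauchy filter is the complement of the union of the
clopen sets that are eventually missed by the sets of the filter.  Let [P] be a
partition and [C] one of the sets of a [P]-small member [S] of the filter.  A
block that [C] does not meet is missed by all of [S], hence by [L].  Conversely,
suppose that [L] does not meet a block [A] that is met by all of [S].  Then the
complement of [A] and the eventually missed clopen sets cover the space; for a
partition [Q] refining this cover, some block of [Q] is met by every set of a
[Q]-small member of the filter although it lies in an eventually missed set. *)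
Lemma partition_space_supercomplete :
  has_clopen_basis X -> ultraparacompact X -> supercomplete (partition_space X).
Proof.
move=> basX uX F FF cF.
have smallF P : clopen_partition P -> exists2 S, F S &
    forall C D, S C -> S D ->
      @hyper_rel (partition_space X) (same_block P) (C, D).
  move=> partP; apply: cauchy_small => //; exists (same_block P) => //.
  by exists P.
pose missed := [set A : set X | clopen A /\
  F [set C : hyperspace (partition_space X) | sval C `&` A = set0]].
have oV : @open X (\bigcup_(A in missed) A).
  by apply: bigcup_open => A [[]].
have cL : closed (~` (\bigcup_(A in missed) A) : set (partition_space X)).
  by apply: open_closedC; rewrite open_partition_space.
exists (exist _ _ cL); apply/cvg_entourageP => H [E [P partP PE] EH].
have [S FS SP] := smallF P partP.
have [cP neP covP trP] := (clopen_partitionP P).1 partP.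
apply: (filterS _ FS) => C SC; apply: EH.
apply: (@hyper_relS (partition_space X) _ _ PE).
split=> /= x.
  move=> Lx; have [A PA Ax] := covP x.
  suff [y [Cy Ay]] : sval C `&` A !=set0 by exists y => //; exists A.
  apply: contrapT => CA0; apply: Lx; exists A => //; split; first exact: cP.
  apply: (filterS _ FS) => D SD; apply/eqP; apply: contrapT => /negP/set0P DA0.
  apply: CA0; exact: (hyper_rel_same_block partP (SP D C SD SC) PA DA0).
move=> Cx; have [A PA Ax] := covP x.
suff [y [Ly Ay]] : ~` (\bigcup_(A in missed) A) `&` A !=set0.
  by exists y => //; exists A.
apply: contrapT => LA0.
have [|Q partQ refQ] := uX (~` A |` missed).
  split; first by move=> B [->|[[]//]]; apply: closed_openC; have [] := cP A PA.
  rewrite -subTset => y _; have [Ay|nAy] := pselect (A y); last first.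
    by exists (~` A) => //; left.
  have [B mB By] : (\bigcup_(A in missed) A) y.
    by apply: contrapT => Ly; apply: LA0; exists y.
  by exists B => //; right.
have [_ _ covQ _] := (clopen_partitionP Q).1 partQ.
have [T FT TQ] := smallF Q partQ.
have [D [SD TD]] := filter_ex (filterI FS FT).
have [y [Dy Ay]] : sval D `&` A !=set0.
  by apply: (hyper_rel_same_block partP (SP C D SC SD) PA); exists x.
have [B QB By] := covQ y.
have [M [MA|mM] BM] := refQ B QB; first by have := BM y By; rewrite MA.
have [_ FM] := mM; have [D' [TD' DM']] := filter_ex (filterI FT FM).
have [z [Dz Bz]] : sval D' `&` B !=set0.
  by apply: (hyper_rel_same_block partQ (TQ D D' TD TD') QB); exists y.
by have : (sval D' `&` _) z := conj Dz (BM z Bz); rewrite DM'.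
Qed.

Lemma ultraparacompact_supercomplete :
  has_clopen_basis X -> ultraparacompact X ->
  has_supercomplete_non_archimedean_uniformity X.
Proof.
move=> basX uX; exists (Uniform.class (partition_space X)); split.
- exact: open_partition_space.
- move=> E [P partP PE]; exists (same_block P); split=> //; first by exists P.
  exact: (same_block_equivalence partP).
- exact: partition_space_supercomplete.
Qed.

End partition_space.

(** * Supercomplete non-Archimedean uniformities *)

Lemma is_equivalenceP {T : Type} (E : set (T * T)) : is_equivalence E ->
  [/\ forall x, E (x, x), forall x y, E (x, y) -> E (y, x) &
      forall y x z, E (x, y) -> E (y, z) -> E (x, z)].
Proof.
move=> [reflE symE trE]; split=> [x|x y Exy|y x z Exy Eyz].
- exact: reflE.
- exact: (symE (y, x)).
- by apply: (trE (x, z)); exists y.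
Qed.

Section supercomplete_ideal.
Context {X : topologicalType} (m : Uniform.axioms_ X).
Let U : uniformType := Uniform.Pack m.
Context (openUX : @open U = @open X).
Implicit Types (E : set (X * X)) (A B : set X).

Lemma equivalence_class_clopen E : @entourage U E -> is_equivalence E ->
  forall x, @clopen X (xsection E x).
Proof.
move=> entE /is_equivalenceP[_ symE trE] x.
split.
  rewrite -openUX openE => y /xsectionP xy.
  rewrite /interior -filter_from_entourageE; exists E => // z /xsectionP yz.
  by apply/xsectionP; exact: trE yz.
rewrite -openC -openUX openE => y /= nxy.
rewrite /interior -filter_from_entourageE; exists E => // z /xsectionP yz.
move=> /xsectionP xz; apply: nxy; apply/xsectionP.
by apply: trE xz _; exact: symE.
Qed.

Lemma class_subset (x : X) (O : set X) : non_archimedean U -> open O -> O x ->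
  exists E, [/\ @entourage U E, is_equivalence E & xsection E x `<=` O].
Proof.
move=> naU; rewrite -openUX openE => /[apply].
rewrite /interior -filter_from_entourageE => -[E0 /naU[E [entE eqE EE0]] E0O].
by exists E; split=> // y /xsectionP /EE0 xy; apply: E0O; apply/xsectionP.
Qed.

Lemma non_archimedean_clopen_basis : non_archimedean U -> has_clopen_basis X.
Proof.
move=> naU; apply/has_clopen_basisP => x O oO Ox.
have [E [entE eqE EO]] := class_subset naU oO Ox.
exists (xsection E x); split=> //; first exact: equivalence_class_clopen.
by apply/xsectionP; have [reflE _ _] := is_equivalenceP eqE.
Qed.

Lemma equivalence_class_partition E : @entourage U E -> is_equivalence E ->
  clopen_partition (range (xsection E)).
Proof.
move=> entE eqE; have [reflE symE trE] := is_equivalenceP eqE.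
have clE x y : xsection E x y <-> E (x, y) by split=> /xsectionP.
apply/clopen_partitionP; split.
- by move=> _ [x _ <-]; exact: equivalence_class_clopen.
- by move=> _ [x _ <-]; exists x; exact/clE.
- by move=> x; exists (xsection E x); [exists x | exact/clE].
- move=> _ _ z [x _ <-] [y _ <-] /clE xz /clE yz.
  have xy : E (x, y) by apply: trE xz _; exact: symE.
  apply/seteqP; split=> t /clE h; apply/clE; last exact: trE h.
  by apply: trE h; exact: symE.
Qed.

(** The filter [F] on the closed sets is generated by the sets [tail A] of the
complements of the members of [I] that contain [A].  It is Cauchy: for an
equivalence entourage [E], let [B0] be the union of the [E]-classes in [I],
which is in [I] by closure under partitions.  If [B] in [I] contains [B0], then
its complement misses the classes in [I] and meets all the others, since a
class contained in [B] would be in [I].  A point of the limit would lie in some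
[A] in [I] together with its class for some [E], and that class is missed by the
complements of all members of [I] that contain [A]; so the limit is empty. *)
Lemma supercomplete_ideal (I : set (set X)) :
  non_archimedean U -> supercomplete U ->
  clopen_ideal I -> \bigcup_(A in I) A = [set: X] -> partition_closed I ->
  I = clopen.
Proof.
move=> naU scU [cI I0 sI uI] covI pI.
pose tail A := [set C : hyperspace U |
  exists B, [/\ I B, A `<=` B & sval C = ~` B]].
have clC B : I B -> @closed U (~` B).
  by move=> IB; apply: open_closedC; rewrite openUX; have [] := cI B IB.
pose F := filter_from I tail.
have FF : ProperFilter F.
  apply: filter_from_proper; last first.
    by move=> A IA; exists (exist _ _ (clC A IA)); exists A; split.
  apply: filter_from_filter; first by exists set0.
  move=> A B IA IB; exists (A `|` B); first exact: uI.
  by move=> C [D [ID ABD CD]]; split; exists D; split=> // x ?; apply: ABD;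
    [left|right].
have cF : cauchy F.
  move=> H [E0 /naU[E [entE eqE EE0]] E0H].
  have partE := equivalence_class_partition entE eqE.
  pose B0 := \bigcup_(A in range (xsection E) `&` I) A.
  have IB0 : I B0 := pI _ partE.
  suff sub C D : tail B0 C -> tail B0 D -> sval C `<=` rel_image E (sval D).
    exists (tail B0, tail B0); first by split; exists B0.
    move=> [C D] [/= tC tD]; apply: E0H; apply: (@hyper_relS U _ _ EE0).
    by split; exact: sub.
  move=> [B [IB B0B ->]] [B' [IB' B0B' ->]] x nBx.
  have [reflE symE _] := is_equivalenceP eqE.
  apply: contrapT => nx; apply: nBx; apply: B0B.
  exists (xsection E x); last exact/xsectionP.
  split; first by exists x.
  apply: sI IB'; first exact: equivalence_class_clopen.
  move=> y /xsectionP xy; apply: contrapT => nB'y; apply: nx; exists y => //.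
  exact: symE.
have [L FL] := scU F FF cF.
have nearL E : @entourage U E -> exists2 A, I A &
    forall C, tail A C -> @hyper_rel U E (L, C).
  move=> entE.
  have /(_ (@hyper_rel U E))[|A IA AE] := (cvg_entourageP FF L).1 FL.
    by exists E.
  by exists A.
have L0 : sval L = set0.
  rewrite -subset0 => x Lx.
  have [A IA Ax] : (\bigcup_(A in I) A) x by rewrite covI.
  have [E [entE eqE EA]] := class_subset naU (cI A IA).1 Ax.
  have [B IB BE] := nearL E entE.
  have [|LC _] := BE (exist _ _ (clC _ (uI A B IA IB))).
    by exists (A `|` B); split=> //; exact: uI.
  have [y nABy Eyx] := LC x Lx; apply: nABy; left; apply: EA.
  by apply/xsectionP; have [_ symE _] := is_equivalenceP eqE; exact: symE.
(* The empty limit is close, even for the coarsest entourage, only to the empty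
   set, so that [A] has empty complement. *)
have [A IA AT] := nearL setT (@entourageT U).
have [|_ CL] := AT (exist _ _ (clC A IA)); first by exists A; split.
have A_full : A = setT.
  rewrite -subTset => x _; apply: contrapT => nAx.
  by have [y] := CL x nAx; rewrite L0.
have IT : I setT by rewrite -A_full.
by apply/seteqP; split=> // B cB; exact: sI IT.
Qed.

End supercomplete_ideal.

Theorem theorem10 (R : realType) (X : topologicalType)
    (hX : hausdorff_space X) :
  [<-> (* 1 *) ultraparacompact X;
       (* 2 *) ultranormal X /\ paracompact X;
       (* 3 *) strongly_zero_dimensional X R /\ paracompact X;
       (* 4 *) forall F : set (set X), open_cover F ->
         exists G, [/\ clopen_cover G, locally_finite G & refines G F];
       (* 5 *) has_clopen_basis X /\
         forall I : set (set X), clopen_ideal I ->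
           \bigcup_(A in I) A = [set: X] -> partition_closed I -> I = clopen;
       (* 6 *) has_clopen_basis X /\
         forall I : set (set X), clopen_ideal I -> partition_closed I ->
           exists2 O, open O & I = [set A | clopen A /\ A `<=` O];
       (* 7 *) has_supercomplete_non_archimedean_uniformity X].
Proof.
have unif_ideal : has_supercomplete_non_archimedean_uniformity X ->
    has_clopen_basis X /\ covering_ideals_improper X.
  move=> [m [openUX naU scU]]; split.
    exact: (non_archimedean_clopen_basis openUX).
  by move=> I; exact: (supercomplete_ideal openUX).
have ideal_upara : has_clopen_basis X -> covering_ideals_improper X ->
    ultraparacompact X.
  move=> basX idX; apply: clopen_refinement_ultraparacompact.
  exact: ideal_clopen_refinement.
have upara_basis : ultraparacompact X -> has_clopen_basis X.
  move=> uX; apply: (@strongly_zero_dimensional_clopen_basis _ R).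
  exact/ultranormal_strongly_zero_dimensional/ultraparacompact_ultranormal.
tfae.
- move=> uX; split; first exact: ultraparacompact_ultranormal.
  exact: ultraparacompact_paracompact.
- by move=> [uX pX]; split=> //; exact: ultranormal_strongly_zero_dimensional.
- move=> [sX pX].
  exact: (strongly_zero_dimensional_paracompact_clopen_refinement sX).
- move=> /clopen_refinement_ultraparacompact uX.
  split; first exact: upara_basis.
  exact: ultraparacompact_ideal.
- by move=> [basX idX]; split=> //; exact: trace_ideal.
- move=> [basX openI].
  apply: ultraparacompact_supercomplete => //; apply: ideal_upara => //.
  move=> I idI covI pI.
  by have [V _ IV] := openI I idI pI; exact: open_ideal IV covI.
- by move=> /unif_ideal[basX idX]; exact: ideal_upara.
Qed.
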